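(* Let $K$ be a reduced commutative ring with $\frac12\in K$, let $n\ge1$, and let $G=\mathrm{Aut}_K(\Lambda_n)$, where $\Lambda_n=\Lambda_n(K)$ is the Grassmann algebra. Then: 1. $\mathrm{Der}_K(\Lambda_n)$ is a faithful $G$-module if and only if $n\ge2$. 2. The $G$-module $\mathrm{Der}_K(\Lambda_n)$ is not simple.
   Context: Rings are associative with $1$. $\Lambda_n=\Lambda_n(K)=K\lfloor x_1,\ldots,x_n\rfloor$ is the $K$-algebra with generators $x_1,\ldots,x_n$ and defining relations $x_i^2=0$ for all $i$ and $x_ix_j=-x_jx_i$ for $i\ne j$. $G=\mathrm{Aut}_K(\Lambda_n)$ is the group of $K$-algebra automorphisms of $\Lambda_n$, and $\mathrm{Der}_K(\Lambda_n)$ is the set of all $K$-derivations of $\Lambda_n$, on which $G$ acts by $\sigma\cdot\delta=\sigma\delta\sigma^{-1}$. A $G$-module $M$ is faithful if the map $G\to\mathrm{End}(M)$ is injective.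
   Formalization: K is nonzero, G-submodules are K-submodules, and part 2 excludes the case where n=1 and K is a field: there Der_K(Λ_1)=K·x d/dx is one-dimensional over K, hence simple, so the printed claim fails. *)

(* Defs.v *)
From HB Require Import structures.
From mathcomp Require Import all_boot all_order all_algebra.
From mathcomp Require Import boolp functions monalg.

Set Implicit Arguments.
Unset Strict Implicit.
Unset Printing Implicit Defensive.

Import GRing.Theory.
Local Open Scope ring_scope.
Local Open Scope quotient_scope.

Section TwoSidedIdeal.
Variables (A : nzRingType) (S : A -> Prop).

Inductive two_sided_ideal : A -> Prop :=
| Ideal0 : two_sided_ideal 0
| IdealGen a r b : S r -> two_sided_ideal (a * r * b)
| IdealAdd f g :
    two_sided_ideal f -> two_sided_ideal g -> two_sided_ideal (f + g).

Lemma two_sided_idealM a f b :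
  two_sided_ideal f -> two_sided_ideal (a * f * b).
Proof.
elim=> [|c r d Sr|f1 f2 _ I1 _ I2].
- by rewrite mulr0 mul0r; exact: Ideal0.
- by rewrite !mulrA -[_ * d * b]mulrA; exact: IdealGen.
- by rewrite mulrDr mulrDl; exact: IdealAdd.
Qed.

Definition ideal_pred : {pred A} := fun f => `[< two_sided_ideal f >].

Lemma ideal_pred_zmod : zmod_closed ideal_pred.
Proof.
split=> [|f g /asboolP If /asboolP Ig]; apply/asboolP; first exact: Ideal0.
by apply: IdealAdd => //; rewrite -mulN1r -[_ * _]mulr1; exact: two_sided_idealM.
Qed.

HB.instance Definition _ := GRing.isZmodClosed.Build A ideal_pred
  ideal_pred_zmod.

Lemma ideal_predM a f b : f \in ideal_pred -> a * f * b \in ideal_pred.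
Proof. by move=> /asboolP If; apply/asboolP; exact: two_sided_idealM. Qed.

Lemma ideal_predMl a f : f \in ideal_pred -> a * f \in ideal_pred.
Proof. by move=> If; rewrite -[_ * _]mulr1; exact: ideal_predM. Qed.

Lemma ideal_predMr f b : f \in ideal_pred -> f * b \in ideal_pred.
Proof. by move=> If; rewrite -[f]mul1r; exact: ideal_predM. Qed.

End TwoSidedIdeal.

Section Grassmann.
Variables (K : comNzRingType) (n : nat).

(* The free associative algebra K<X_1, ..., X_n>: the monoid algebra of the   *)
(* free monoid on n letters.                                                  *)
Local Notation free_alg := {malg K[{fmonom 'I_n}]}.

Definition free_var (i : 'I_n) : free_alg := << fmu i >>.

(* Each relation u = v is encoded as the element u - v of the free algebra.   *)
Definition grassmann_rel (r : free_alg) : Prop :=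
  (exists i, r = free_var i * free_var i) \/
  (exists i j, i != j /\
     r = free_var i * free_var j - (- (free_var j * free_var i))).

Definition grassmann_ideal : {pred free_alg} := ideal_pred grassmann_rel.
HB.instance Definition _ := GRing.ZmodClosed.on grassmann_ideal.

Definition grassmann : Type := Quotient.quot grassmann_ideal.
HB.instance Definition _ := GRing.Zmodule.on grassmann.
HB.instance Definition _ := Quotient.on grassmann.

Definition free_pi (f : free_alg) : grassmann := \pi_grassmann f.

Lemma free_pi_eq f g : (free_pi f == free_pi g) = (f - g \in grassmann_ideal).
Proof. by rewrite (Quotient.idealrBE grassmann_ideal). Qed.

Lemma free_piB f g : f - g \in grassmann_ideal -> free_pi f = free_pi g.
Proof. by rewrite -free_pi_eq => /eqP. Qed.

Lemma repr_free_pi f : repr (free_pi f) - f \in grassmann_ideal.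
Proof. by rewrite -free_pi_eq /free_pi reprK. Qed.

Lemma free_piK (x : grassmann) : free_pi (repr x) = x.
Proof. exact: reprK. Qed.

Lemma free_piD f g : free_pi f + free_pi g = free_pi (f + g).
Proof. exact: esym (Quotient.pi_add grassmann_ideal f g). Qed.

(* repr x is a chosen representative in the free algebra; free_piM, free_piZ  *)
(* show that the operations are the ones induced on the quotient.             *)
Definition gr_mul (x y : grassmann) : grassmann := free_pi (repr x * repr y).
Definition gr_one : grassmann := free_pi 1.
Definition gr_scale (a : K) (x : grassmann) : grassmann :=
  free_pi (a *: repr x).

Lemma free_piM f g : gr_mul (free_pi f) (free_pi g) = free_pi (f * g).
Proof.
apply: free_piB; set f' := repr _; set g' := repr _.
have -> : f' * g' - f * g = (f' - f) * g' + f * (g' - g).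
  by rewrite mulrBl mulrBr addrA subrK.
by apply: rpredD; [apply: ideal_predMr|apply: ideal_predMl];
   exact: repr_free_pi.
Qed.

Lemma free_piZ a f : gr_scale a (free_pi f) = free_pi (a *: f).
Proof.
apply: free_piB; rewrite -scalerBr -[_ - f]mul1r scalerAl.
exact/ideal_predMl/repr_free_pi.
Qed.

Lemma gr_mulA : associative gr_mul.
Proof.
move=> x y z; rewrite -(free_piK x) -(free_piK y) -(free_piK z).
by rewrite !free_piM mulrA.
Qed.

Lemma gr_mul1 : left_id gr_one gr_mul.
Proof. by move=> x; rewrite -(free_piK x) free_piM mul1r. Qed.

Lemma gr_mulr1 : right_id gr_one gr_mul.
Proof. by move=> x; rewrite -(free_piK x) free_piM mulr1. Qed.

Lemma gr_mulDl : left_distributive gr_mul +%R.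
Proof.
move=> x y z; rewrite -(free_piK x) -(free_piK y) -(free_piK z).
by rewrite !(free_piD, free_piM) mulrDl.
Qed.

Lemma gr_mulDr : right_distributive gr_mul +%R.
Proof.
move=> x y z; rewrite -(free_piK x) -(free_piK y) -(free_piK z).
by rewrite !(free_piD, free_piM) mulrDr.
Qed.

Lemma free_var_coef0 i : mcoeff (mone : {fmonom 'I_n}) (free_var i) = 0 :> K.
Proof.
by rewrite /free_var mcoeffU1 -[_ == _]/(fmu i == fmone _) fmP fmuE fmoneE.
Qed.

Lemma grassmann_ideal_coef0 (f : free_alg) :
  two_sided_ideal grassmann_rel f -> mcoeff (mone : {fmonom 'I_n}) f = 0 :> K.
Proof.
elim=> [|a r b Sr|g h _ Ig _ Ih]; first exact: mcoeff0.
  rewrite !rmorphM /=; suff -> : mcoeff (mone : {fmonom 'I_n}) r = 0 :> K by rewrite mulr0 mul0r.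
  case: Sr => [[i ->]|[i [j [_ ->]]]]; first by rewrite rmorphM /= free_var_coef0 mul0r.
  by rewrite rmorphB rmorphN !rmorphM /= !free_var_coef0 !mulr0 !oppr0 addr0.
by rewrite mcoeffD Ig Ih addr0.
Qed.

Lemma gr_one_neq0 : gr_one != 0.
Proof.
have pi0 : free_pi 0 = 0.
  by apply: (@addrI _ (free_pi 0)); rewrite (free_piD 0 0) (addr0 (free_pi 0)) (addr0 0).
rewrite -pi0 /gr_one free_pi_eq subr0; apply/negP => /asboolP/grassmann_ideal_coef0.
by move/eqP; rewrite rmorph1 oner_eq0.
Qed.

HB.instance Definition _ := GRing.Zmodule_isNzRing.Build grassmann
  gr_mulA gr_mul1 gr_mulr1 gr_mulDl gr_mulDr gr_one_neq0.

Lemma gr_scaleA a b x : gr_scale a (gr_scale b x) = gr_scale (a * b) x.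
Proof. by rewrite -(free_piK x) !free_piZ scalerA. Qed.

Lemma gr_scale1 : left_id 1 gr_scale.
Proof. by move=> x; rewrite -(free_piK x) free_piZ scale1r. Qed.

Lemma gr_scaleDr : right_distributive gr_scale +%R.
Proof.
move=> a x y; rewrite -(free_piK x) -(free_piK y).
by rewrite !(free_piD, free_piZ) scalerDr.
Qed.

Lemma gr_scaleDl x : {morph gr_scale^~ x : a b / a + b}.
Proof. by move=> a b; rewrite -(free_piK x) !free_piZ free_piD scalerDl. Qed.

HB.instance Definition _ := GRing.Zmodule_isLmodule.Build K grassmann
  gr_scaleA gr_scale1 gr_scaleDr gr_scaleDl.

Lemma free_pi_mul f g : free_pi f * free_pi g = free_pi (f * g).
Proof. exact: free_piM. Qed.

Lemma free_pi_scale a f : a *: free_pi f = free_pi (a *: f).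
Proof. exact: free_piZ. Qed.

Lemma gr_scaleAl a (x y : grassmann) : a *: (x * y) = (a *: x) * y.
Proof.
rewrite -(free_piK x) -(free_piK y).
by rewrite (free_pi_mul, free_pi_scale) !(free_pi_mul, free_pi_scale) scalerAl.
Qed.

HB.instance Definition _ := GRing.Lmodule_isLalgebra.Build K grassmann
  gr_scaleAl.

Lemma free_alg_scaleAr a (f g : free_alg) : a *: (f * g) = f * (a *: g).
Proof.
have cc (h : free_alg) : a%:MP * h = h * a%:MP.
  rewrite [LHS]fgmulUg [RHS]fgmulgU; apply: eq_bigr => k _.
  by rewrite mulrC mul1m mulm1.
by rewrite -!mul_malgC !mulrA cc.
Qed.

Lemma gr_scaleAr a (x y : grassmann) : a *: (x * y) = x * (a *: y).
Proof.
rewrite -(free_piK x) -(free_piK y).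
by rewrite (free_pi_mul, free_pi_scale) !(free_pi_mul, free_pi_scale) free_alg_scaleAr.
Qed.

HB.instance Definition _ := GRing.Lalgebra_isAlgebra.Build K grassmann
  gr_scaleAr.

End Grassmann.

Section AlgebraAutomorphisms.
Variables (K : comNzRingType) (A : algType K).
Implicit Types (f : A -> A).

Definition is_alg_aut f := [/\ linear f, monoid_morphism f & bijective f].

Record alg_aut := AlgAut { aut_fun :> A -> A; _ : `[< is_alg_aut aut_fun >] }.
HB.instance Definition _ := [isSub for aut_fun].
HB.instance Definition _ := [Choice of alg_aut by <:].

Implicit Types (s t : alg_aut).

Lemma alg_autP s : is_alg_aut s.
Proof. by case: s => f fP; exact/asboolP. Qed.

Lemma alg_aut_eq s t : s =1 t -> s = t.
Proof. by move=> st; apply/val_inj/funext. Qed.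

Lemma aut_inv_exists s : exists g : A -> A, cancel s g /\ cancel g s.
Proof. by case: (alg_autP s) => _ _ [g sK gK]; exists g. Qed.

Definition aut_inv_fun s : A -> A := projT1 (cid (aut_inv_exists s)).

Lemma aut_funK s : cancel s (aut_inv_fun s).
Proof. by rewrite /aut_inv_fun; case: cid => g []. Qed.

Lemma aut_inv_funK s : cancel (aut_inv_fun s) s.
Proof. by rewrite /aut_inv_fun; case: cid => g []. Qed.

Fact id_is_alg_aut : `[< is_alg_aut id >].
Proof. by apply/asboolP; split=> //; exists id. Qed.

Fact comp_is_alg_aut s t : `[< is_alg_aut (s \o t) >].
Proof.
apply/asboolP; have [sL [s1 sM] sB] := alg_autP s.
have [tL [t1 tM] tB] := alg_autP t.
split; last exact: bij_comp.
- by move=> a x y /=; rewrite tL sL.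
- by split=> [|x y] /=; rewrite ?t1 ?s1 ?tM ?sM.
Qed.

Fact inv_is_alg_aut s : `[< is_alg_aut (aut_inv_fun s) >].
Proof.
have [sL [s1 sM] sB] := alg_autP s; have sI := bij_inj sB.
apply/asboolP; split.
- by move=> a x y; apply: sI; rewrite sL !aut_inv_funK.
- by split=> [|x y]; apply: sI; rewrite ?s1 ?sM !aut_inv_funK.
- by exists s; [exact: aut_inv_funK | exact: aut_funK].
Qed.

Definition aut_one := AlgAut id_is_alg_aut.
Definition aut_mul s t := AlgAut (comp_is_alg_aut s t).
Definition aut_inv s := AlgAut (inv_is_alg_aut s).

Lemma aut_mulA : associative aut_mul.
Proof. by move=> s t u; apply: alg_aut_eq. Qed.

Lemma aut_mul1 : left_id aut_one aut_mul.
Proof. by move=> s; apply: alg_aut_eq. Qed.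

Lemma aut_mulr1 : right_id aut_one aut_mul.
Proof. by move=> s; apply: alg_aut_eq. Qed.

Lemma aut_mulV : left_inverse aut_one aut_inv aut_mul.
Proof. by move=> s; apply: alg_aut_eq => x; exact: aut_funK. Qed.

Lemma aut_mulrV : right_inverse aut_one aut_inv aut_mul.
Proof. by move=> s; apply: alg_aut_eq => x; exact: aut_inv_funK. Qed.

HB.instance Definition _ := isGroup.Build alg_aut
  aut_mulA aut_mul1 aut_mulr1 aut_mulV aut_mulrV.

End AlgebraAutomorphisms.

Section Derivations.
Variables (K : comNzRingType) (A : algType K).

Definition is_derivation (d : A -> A) :=
  linear d /\ forall a b, d (a * b) = d a * b + a * d b.

Definition derivation_pred : {pred A -> A} := fun d => `[< is_derivation d >].

Lemma derivation_submod : submod_closed derivation_pred.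
Proof.
split=> [|c d e /asboolP[dL dM] /asboolP[eL eM]]; apply/asboolP.
  split=> [a x y|a b]; first by rewrite -[RHS]/(a *: 0 + 0) scaler0 addr0.
  by rewrite -[RHS]/(0 * b + a * 0) mul0r mulr0 addr0.
have E x : (c *: d + e) x = c *: d x + e x by [].
split.
- move=> a x y; rewrite !E dL eL !scalerDr !scalerA (mulrC c a).
  by rewrite addrACA.
- move=> a b; rewrite !E dM eM scalerDr mulrDl mulrDr scalerAl scalerAr.
  by rewrite addrACA.
Qed.

HB.instance Definition _ := GRing.isSubmodClosed.Build K (A -> A)
  derivation_pred derivation_submod.

Record derivation := Derivation
  { der_fun :> A -> A; _ : der_fun \in derivation_pred }.
HB.instance Definition _ := [isSub for der_fun].
HB.instance Definition _ := [Choice of derivation by <:].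
HB.instance Definition _ := [SubChoice_isSubLmodule of derivation by <:].

Implicit Types (d e : derivation) (s t : alg_aut A).

Lemma derivationP d : is_derivation d.
Proof. by case: d => f fP; exact/asboolP. Qed.

Lemma derivation_eq d e : d =1 e -> d = e.
Proof. by move=> de; apply/val_inj/funext. Qed.

Fact der_act_subproof s d : (s \o d \o (s^-1)%g) \in derivation_pred.
Proof.
have [sL [_ sM] _] := alg_autP s; have [/= tL [_ /= tM] _] := alg_autP (s^-1)%g.
have [dL dM] := derivationP d.
apply/asboolP; split=> [a x y|a b] /=; first by rewrite tL dL sL.
rewrite tM dM; have -> x y : s (x + y) = s x + s y.
  by rewrite -[x]scale1r sL !scale1r.
by rewrite !sM !aut_inv_funK.
Qed.

(* s . d = s d s^-1; the product of alg_aut is composition.                   *)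
Definition der_act s d : derivation := Derivation (der_act_subproof s d).

Lemma der_act_linear s : linear (der_act s).
Proof.
have [sL _ _] := alg_autP s.
by move=> a d e; apply: derivation_eq => x; rewrite /= sL.
Qed.

Lemma der_act1 d : der_act 1%g d = d.
Proof.
apply: derivation_eq => x.
by rewrite -[LHS]/(d ((1^-1 : alg_aut A)%g x)) invg1.
Qed.

Lemma der_actM s t d : der_act (s * t)%g d = der_act s (der_act t d).
Proof.
apply: derivation_eq => x.
by rewrite -[LHS]/(s (t (d (((s * t)^-1)%g x)))) invgM.
Qed.

End Derivations.

(* A G-module here is a K-module with a K-linear action of G, and submodules   *)
(* are the G-stable K-submodules; hence non-simplicity in this sense implies  *)
(* non-simplicity with respect to all G-stable additive subgroups.            *)
Record gmodule (G : groupType) (K : pzRingType) := GModule {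
  gmod_sort :> lmodType K;
  gact : G -> gmod_sort -> gmod_sort;
  _ : forall g, linear (gact g);
  _ : forall m, gact 1%g m = m;
  _ : forall g h m, gact (g * h)%g m = gact g (gact h m)
}.

Section GModule.
Variables (G : groupType) (K : pzRingType) (M : gmodule G K).

Definition faithful_gmodule := injective (@gact G K M).

Definition gsubmodule (U : M -> Prop) :=
  [/\ U 0, forall (a : K) m m', U m -> U m' -> U (a *: m + m') &
      forall g m, U m -> U (gact g m)].

Definition simple_gmodule :=
  (exists m : M, m != 0) /\
  forall U : M -> Prop, gsubmodule U ->
    (forall m, U m -> m = 0) \/ (forall m, U m).

End GModule.

Definition Der (K : comNzRingType) (A : algType K) : gmodule (alg_aut A) K :=
  GModule (@der_act_linear K A) (@der_act1 K A) (@der_actM K A).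

Definition reduced (K : comNzRingType) :=
  forall (a : K) (m : nat), a ^+ m = 0 -> a = 0.

Definition is_field (K : comNzRingType) :=
  forall a : K, a != 0 -> exists b, a * b = 1.

(* Main.v *)
(* Let D_i be the derivation multiplying a monomial by its degree in x_i. If  *)
(* u commutes with every derivation then u(x_j) is a common eigenvector of    *)
(* the D_i with the weight of x_j, hence u(x_j) = c_j x_j; commuting with the *)
(* inner derivation [x_i, -] gives c_i c_j = c_j, so c_i = 1 as soon as some  *)
(* j != i exists. For n = 1 the automorphism x |-> -x acts trivially. For     *)
(* n >= 2 the inner derivations form a proper nonzero submodule, since        *)
(* [x_i, x_j] = 2 x_i x_j, while D_i is not inner because commutators have no *)
(* linear part. For n = 1 and a nonzero nonunit a of K, one takes a Der.      *)
Require Import Defs.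
From HB Require Import structures.
From mathcomp Require Import all_boot all_order all_algebra.
From mathcomp Require Import boolp monalg.

Set Implicit Arguments.
Unset Strict Implicit.
Unset Printing Implicit Defensive.

Import GRing.Theory.
Local Open Scope ring_scope.

(** The Grassmann algebra is graded by multidegree, and the derivations [gr_der] detect this
    grading. An automorphism that acts trivially on derivations commutes with all of them, so it
    scales each generator ([weight_x]); given two generators, the inner derivations force the
    scalars to be 1 ([commute_der_id]). With a single generator x every derivation is b x d/dx, and
    the automorphism x -> -x commutes with it ([one_var_der], [not_faithful_Der]). A proper nonzero
    submodule consists of the inner derivations if n >= 2, and of the multiples of a nonzero nonunit
    of K if n = 1.

    The independence required in the quotient comes from two kinds of functionals on the free
    algebra that vanish on the defining ideal: the coefficient of a single letter ([ideal_coef1]),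
    and the difference of the coefficients of ij and ji ([ideal_coef2]). *)

(** * Low-degree coefficients and degree derivations on the free algebra *)

(* F models the free algebra: w s is the monomial with letters s, x i the i-th *)
(* variable, coef s the coefficient of w s, and D i multiplies a monomial by   *)
(* its degree in x i.                                                          *)
Section WordAlgebra.
Variables (K : comNzRingType) (I : eqType) (F : lalgType K).
Variables (x : I -> F) (w : seq I -> F) (coef : seq I -> {scalar F}).
Variable (D : I -> {linear F -> F}).
Hypothesis scaleAr : forall c (f g : F), c *: (f * g) = f * (c *: g).
Hypothesis xE : forall i, x i = w [:: i].
Hypothesis wM : forall s t, w s * w t = w (s ++ t).
Hypothesis w_ind : forall P : F -> Prop,
  P 0 -> (forall f g, P f -> P g -> P (f + g)) ->
  (forall c s, P (c *: w s)) -> forall f, P f.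
Hypothesis coef_w : forall s t, coef t (w s) = (s == t)%:R.
Hypothesis D_w : forall i s, D i (w s) = (count_mem i s)%:R *: w s.
Implicit Types (f g r : F) (i j k : I) (s t : seq I).

Lemma coefM0 f g : coef [::] (f * g) = coef [::] f * coef [::] g.
Proof.
elim/w_ind: f => [|f1 f2 I1 I2|c s].
- by rewrite mul0r !linear0 mul0r.
- by rewrite mulrDl !linearD I1 I2 !mulrDl.
elim/w_ind: g => [|g1 g2 I1 I2|d t].
- by rewrite mulr0 !linear0 mulr0.
- by rewrite mulrDr !linearD I1 I2 !mulrDr.
rewrite -scaleAr -scalerAl wM !linearZ /= !coef_w /=.
rewrite [c * _ * _]mulrACA mulrA [d * c]mulrC; congr (_ * _).
by case: s => [|k s]; case: t => [|l t];
  rewrite /= ?(mulr1, mulr0, mul0r).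
Qed.

(** A word of length one is a concatenation in two ways; the three terms of [coefM2] arise likewise
    from a word of length two. *)
Lemma coefM1 i f g :
  coef [:: i] (f * g) =
    coef [::] f * coef [:: i] g + coef [:: i] f * coef [::] g.
Proof.
elim/w_ind: f => [|f1 f2 I1 I2|c s].
- by rewrite mul0r !linear0 !mul0r addr0.
- by rewrite mulrDl !linearD I1 I2 !mulrDl addrACA.
elim/w_ind: g => [|g1 g2 I1 I2|d t].
- by rewrite mulr0 !linear0 !mulr0 addr0.
- by rewrite mulrDr !linearD I1 I2 !mulrDr addrACA.
rewrite -scaleAr -scalerAl wM !linearZ /= !coef_w /=.
have E a b : c * a * (d * b) = d * c * (a * b) by rewrite mulrACA [c * d]mulrC.
rewrite !E -!mulrDr mulrA; congr (_ * _).
by case: s => [|k [|l s]]; case: t => [|k' [|l' t]];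
  rewrite /= ?eqseq_cons ?eqxx ?andbF ?andbT ?(mulr1, mulr0, mul0r, mul1r, addr0, add0r).
Qed.

Lemma coefM2 i j f g :
  coef [:: i; j] (f * g) =
    coef [::] f * coef [:: i; j] g + coef [:: i] f * coef [:: j] g +
    coef [:: i; j] f * coef [::] g.
Proof.
elim/w_ind: f => [|f1 f2 I1 I2|c s].
- by rewrite mul0r !linear0 !mul0r !addr0.
- by rewrite mulrDl !linearD I1 I2 !mulrDl addrACA; congr (_ + _); rewrite addrACA.
elim/w_ind: g => [|g1 g2 I1 I2|d t].
- by rewrite mulr0 !linear0 !mulr0 !addr0.
- by rewrite mulrDr !linearD I1 I2 !mulrDr addrACA; congr (_ + _); rewrite addrACA.
rewrite -scaleAr -scalerAl wM !linearZ /= !coef_w /=.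
have E a b : c * a * (d * b) = d * c * (a * b) by rewrite mulrACA [c * d]mulrC.
rewrite !E -!mulrDr mulrA; congr (_ * _).
by case: s => [|k [|l [|m s]]]; case: t => [|k' [|l' [|m' t]]];
  rewrite /= ?eqseq_cons ?eqxx ?andbF ?andbT -?natrM ?mulnb ?mul1n ?muln1 ?muln0 ?andbF
    ?(mulr1, mulr0, mul0r, mul1r, addr0, add0r).
Qed.

Lemma word_derM i f g : D i (f * g) = D i f * g + f * D i g.
Proof.
elim/w_ind: f => [|f1 f2 I1 I2|c s].
- by rewrite !mul0r linear0 mul0r addr0.
- by rewrite mulrDl !linearD I1 I2 !mulrDl addrACA.
elim/w_ind: g => [|g1 g2 I1 I2|d t].
- by rewrite !mulr0 linear0 mulr0 addr0.
- by rewrite mulrDr !linearD I1 I2 !mulrDr addrACA.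
have E a b : (a *: w s) * (b *: w t) = (a * b) *: w (s ++ t).
  by rewrite -scalerAl -scaleAr wM scalerA.
rewrite E !linearZ /= !D_w !scalerA !E -scalerDl count_cat natrD mulrDr.
by congr ((_ + _) *: _); rewrite ?mulrA // mulrAC.
Qed.

Let rel r :=
  (exists i, r = x i * x i) \/
  (exists i j, i != j /\ r = x i * x j - (- (x j * x i))).

(** Each relation is homogeneous for the multidegree, hence an eigenvector of [D i]; this is what
    lets [D i] descend to the quotient. *)
Lemma word_der_rel i r : rel r -> exists c, D i r = c *: r.
Proof.
case=> [[k ->]|[k [l [_ ->]]]]; rewrite ?opprK !xE !wM /=.
  by exists (count_mem i [:: k; k])%:R; rewrite D_w.
exists (count_mem i [:: k; l])%:R; rewrite linearD !D_w scalerDr /=.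
by rewrite !addn0 (addnC (l == i)).
Qed.

Lemma word_der_ideal i f : two_sided_ideal rel f -> two_sided_ideal rel (D i f).
Proof.
elim=> [|a r b Sr|f1 f2 _ I1 _ I2].
- by rewrite linear0; exact: Ideal0.
- rewrite !word_derM; have [c ->] := word_der_rel i Sr.
  rewrite mulrDl; apply: IdealAdd; last exact: IdealGen.
  apply: IdealAdd; first exact: IdealGen.
  by rewrite -scaleAr scalerAl; exact: IdealGen.
- by rewrite linearD; exact: IdealAdd.
Qed.

(** The relations have neither constant nor linear part, so no multiple of them has one. *)
Lemma ideal_coef1 i f : two_sided_ideal rel f -> coef [:: i] f = 0.
Proof.
elim=> [|a r b Sr|f1 f2 _ I1 _ I2].
- exact: linear0.
- have E0 u v : coef [::] (w [:: u; v]) = 0 by rewrite coef_w.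
  have E1 u v : coef [:: i] (w [:: u; v]) = 0 by rewrite coef_w eqseq_cons andbF.
  rewrite !(coefM0, coefM1); case: Sr => [[k ->]|[k [l [_ ->]]]];
    by rewrite ?opprK !xE !wM ?linearD /= !(E0, E1, addr0, mulr0, mul0r).
- by rewrite linearD I1 I2 addr0.
Qed.

(** In degree two, [a * r * b] is the multiple of [r] by the constant terms of [a] and [b], and each
    relation [r] is symmetric in two distinct letters. *)
Lemma ideal_coef2 i j f : i != j -> two_sided_ideal rel f ->
  coef [:: i; j] f = coef [:: j; i] f.
Proof.
move=> ij; elim=> [|a r b Sr|f1 f2 _ I1 _ I2].
- by rewrite !linear0.
- have rE : [/\ coef [::] r = 0, forall k, coef [:: k] r = 0
             & coef [:: i; j] r = coef [:: j; i] r].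
    case: Sr => [[k ->]|[k [l [_ ->]]]]; rewrite ?opprK !xE !wM;
      split=> [|m|]; rewrite ?linearD /= !coef_w ?addr0 //=
              !eqseq_cons ?andbF ?andbT ?addr0 //.
      by case: eqVneq => [->|_]; rewrite ?(negPf ij) ?andbF.
    by rewrite addrC ![(l == _) && _]andbC.
  case: rE => r0 r1 r2.
  by rewrite !(coefM0, coefM1, coefM2) r0 !r1 r2 !(mulr0, mul0r, addr0, add0r).
- by rewrite !linearD /= I1 I2.
Qed.

Lemma coef1_comm i f g : coef [:: i] (f * g) = coef [:: i] (g * f).
Proof. by rewrite !coefM1 addrC; congr (_ + _); rewrite mulrC. Qed.

End WordAlgebra.

(** * Descent to the Grassmann algebra *)

Section Grassmann.
Variables (K : comNzRingType) (n : nat).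
Local Notation free_alg := {malg K[{fmonom 'I_n}]}.
Local Notation Lam := (grassmann K n).
Implicit Types (f g : free_alg) (s t : seq 'I_n) (i j : 'I_n).
Implicit Types (y z : Lam) (c : K).

Definition word s : free_alg := << FMonom s >>.

Lemma wordM s t : word s * word t = word (s ++ t).
Proof. by rewrite [LHS]fgmulUU mulr1 /mmul /= fmmulE. Qed.

Lemma word_nil : word [::] = 1.
Proof. by rewrite /word -fmoneE. Qed.

Lemma free_varE i : free_var K i = word [:: i].
Proof. by rewrite /free_var fmuE. Qed.

Lemma scale_word c s : c *: word s = << c *g FMonom s >>.
Proof. by rewrite -mul_malgC [LHS]fgmulUU mulr1 mul1m. Qed.

Lemma word_ind (P : free_alg -> Prop) :
    P 0 -> (forall f g, P f -> P g -> P (f + g)) ->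
    (forall c s, P (c *: word s)) ->
  forall f, P f.
Proof.
move=> P0 PD PU f; rewrite [f]monalgE.
by apply: big_ind => // m _; case: m => s; rewrite -scale_word.
Qed.

Lemma mcoeff_word s t : mcoeff (FMonom t) (word s) = (s == t)%:R :> K.
Proof. exact: mcoeffU1. Qed.

(** Here [mmap] only extends linearly from words: the map on words is not multiplicative, and the
    Leibniz rule comes from [word_derM]. *)
Definition free_der i : free_alg -> free_alg :=
  mmap (@malgC {fmonom 'I_n} K)
       (fun m : {fmonom 'I_n} => (count_mem i m)%:R *: << m >>).

Lemma free_derU i c s :
  free_der i (c *: word s) = c *: ((count_mem i s)%:R *: word s).
Proof. by rewrite scale_word [LHS]mmapU mul_malgC. Qed.

Fact free_der_linear i : linear (free_der i).
Proof.
have derD f g : free_der i (f + g) = free_der i f + free_der i g.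
  exact: mmapD.
move=> c f g; rewrite (derD (c *: f)); congr (_ + _).
elim/word_ind: f => [|f1 f2 I1 I2|d s].
- by rewrite !scaler0 [free_der i 0]mmap0 scaler0.
- rewrite scalerDr (derD (c *: f1)) (derD f1) scalerDr.
  exact: (congr2 +%R I1 I2).
- apply: etrans (etrans (congr1 (free_der i) (scalerA c d _)) (free_derU i _ s)) _.
  move: (free_derU i d s); move: (free_der i _) => u ->.
  exact: esym (scalerA c d _).
Qed.

HB.instance Definition _ i :=
  GRing.isLinear.Build K free_alg free_alg *:%R (free_der i)
    (free_der_linear i).

Lemma free_der_word i s : free_der i (word s) = (count_mem i s)%:R *: word s.
Proof. by rewrite -[word s in LHS]scale1r free_derU scale1r. Qed.

Lemma free_der_ideal i f :
  f \in @grassmann_ideal K n -> free_der i f \in @grassmann_ideal K n.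
Proof.
move=> /asboolP If; apply/asboolP.
exact: (word_der_ideal (@free_alg_scaleAr K n) free_varE wordM word_ind
  free_der_word i If).
Qed.

Lemma ideal_mcoeff1 i f :
  f \in @grassmann_ideal K n -> mcoeff (FMonom [:: i]) f = 0.
Proof.
move=> /asboolP; exact: (ideal_coef1 (coef := fun s => mcoeff (FMonom s))
  (@free_alg_scaleAr K n) free_varE wordM word_ind mcoeff_word).
Qed.

Lemma ideal_mcoeff2 i j f : i != j -> f \in @grassmann_ideal K n ->
  mcoeff (FMonom [:: i; j]) f = mcoeff (FMonom [:: j; i]) f.
Proof.
move=> ij /asboolP; exact: (ideal_coef2 (coef := fun s => mcoeff (FMonom s))
  (@free_alg_scaleAr K n) free_varE wordM word_ind mcoeff_word).
Qed.

Lemma mcoeff1_comm i f g :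
  mcoeff (FMonom [:: i]) (f * g) = mcoeff (FMonom [:: i]) (g * f).
Proof.
exact: (coef1_comm (coef := fun s => mcoeff (FMonom s))
  (@free_alg_scaleAr K n) wordM word_ind mcoeff_word).
Qed.

Definition mon s : Lam := free_pi (word s).

Lemma free_pi0 : free_pi 0 = 0 :> Lam.
Proof. by rewrite -[0 in LHS](scale0r 0) -free_pi_scale scale0r. Qed.

Lemma free_pi_eq0 f : f \in @grassmann_ideal K n -> free_pi f = 0.
Proof. by move=> If; rewrite -free_pi0; apply: free_piB; rewrite subr0. Qed.

Lemma monM s t : mon s * mon t = mon (s ++ t).
Proof. by rewrite /mon free_pi_mul wordM. Qed.

Lemma mon_nil : mon [::] = 1.
Proof. by rewrite /mon word_nil. Qed.

Lemma mon_ind (P : Lam -> Prop) :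
    P 0 -> (forall y z, P y -> P z -> P (y + z)) ->
    (forall c s, P (c *: mon s)) ->
  forall y, P y.
Proof.
move=> P0 PD PU y; rewrite -(free_piK y); move: (repr y) => f.
elim/word_ind: f => [|f g If Ig|c s]; first by rewrite free_pi0.
- by rewrite -free_piD; exact: PD.
- by rewrite -free_pi_scale; exact: PU.
Qed.

Lemma grassmann_rel_ideal f : grassmann_rel f -> f \in @grassmann_ideal K n.
Proof.
by move=> Rf; apply/asboolP; rewrite -[f]mul1r -[1 * f]mulr1; exact: IdealGen.
Qed.

Lemma mon_sqr i : mon [:: i] * mon [:: i] = 0.
Proof.
rewrite /mon free_pi_mul -free_varE; apply/free_pi_eq0/grassmann_rel_ideal.
by left; exists i.
Qed.

Lemma mon_anticomm i j : i != j ->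
  mon [:: i] * mon [:: j] = - (mon [:: j] * mon [:: i]).
Proof.
move=> ij; rewrite /mon -!free_varE.
have E : free_pi (free_var K i * free_var K j) +
         free_pi (free_var K j * free_var K i) = 0 :> Lam.
  apply: etrans (free_piD _ _) _; apply/free_pi_eq0/grassmann_rel_ideal.
  by right; exists i, j; rewrite opprK.
apply: etrans (free_pi_mul _ _) _.
apply: etrans _ (congr1 -%R (esym (free_pi_mul _ _))).
have addr_eq0_oppr (y z : Lam) : y + z = 0 -> y = - z.
  by move/eqP; rewrite addr_eq0 => /eqP.
exact: addr_eq0_oppr E.
Qed.

Lemma free_pi_mcoeff1 i f g : free_pi f = free_pi g :> Lam ->
  mcoeff (FMonom [:: i]) f = mcoeff (FMonom [:: i]) g.
Proof.
move/eqP; rewrite free_pi_eq => /(ideal_mcoeff1 i) /eqP.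
by rewrite mcoeffB subr_eq0 => /eqP.
Qed.

Lemma scale_mon1_inj i c c' : c *: mon [:: i] = c' *: mon [:: i] -> c = c'.
Proof.
rewrite /mon !free_pi_scale => /(free_pi_mcoeff1 i).
by rewrite !mcoeffZ mcoeff_word eqxx !mulr1.
Qed.

(** The coefficient of ij minus that of ji vanishes on the ideal and equals [c] on this element. *)
Lemma scale_mon2_eq0 i j c : i != j -> c *: (mon [:: i] * mon [:: j]) = 0 -> c = 0.
Proof.
move=> ij; rewrite monM /mon free_pi_scale -free_pi0 => /eqP.
rewrite free_pi_eq subr0 => /(ideal_mcoeff2 ij).
rewrite !mcoeffZ !mcoeff_word eqxx mulr1 => ->.
by rewrite !eqseq_cons (negPf ij) mulr0.
Qed.

(** The coefficient of the letter [i] is well defined on the quotient; it is 0 on commutators and 1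
    on the generator. *)
Lemma commutator_neq_mon1 i y z : y * z - z * y != mon [:: i].
Proof.
apply/eqP => /eqP; rewrite subr_eq => /eqP.
rewrite -(free_piK y) -(free_piK z) !free_pi_mul /mon free_piD.
move=> /(free_pi_mcoeff1 i)/(etrans (mcoeff1_comm i (repr z) (repr y))).
rewrite (mcoeffD _ (word [:: i])) mcoeff_word eqxx.
by rewrite -[LHS]add0r => /addIr/esym/eqP; rewrite oner_eq0.
Qed.

Definition gr_der_fun i y : Lam := free_pi (free_der i (repr y)).

Lemma gr_der_pi i f : gr_der_fun i (free_pi f) = free_pi (free_der i f).
Proof.
by apply: free_piB; rewrite -linearB free_der_ideal ?repr_free_pi.
Qed.

Fact gr_der_subproof i : gr_der_fun i \in @derivation_pred K Lam.
Proof.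
have piP c f g : c *: free_pi f + free_pi g = free_pi (c *: f + g) :> Lam.
  by rewrite free_pi_scale free_piD.
apply/asboolP; split=> [c y z|y z]; rewrite -(free_piK y) -(free_piK z).
  rewrite piP !gr_der_pi piP.
  by congr free_pi; exact: linearP.
rewrite free_pi_mul !gr_der_pi !free_pi_mul free_piD; congr free_pi.
exact: (word_derM (@free_alg_scaleAr K n) wordM word_ind free_der_word).
Qed.

Definition gr_der i : derivation Lam := Derivation (gr_der_subproof i).

Lemma gr_der_mon i s : gr_der i (mon s) = (count_mem i s)%:R *: mon s.
Proof. by rewrite [LHS]gr_der_pi free_der_word -free_pi_scale. Qed.

End Grassmann.

(** * Stable submodules of derivations of a general algebra *)

Section AutomorphismsAndDerivations.
Variables (K : comNzRingType) (A : algType K).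
Implicit Types (u : alg_aut A) (d : derivation A) (y z : A) (c : K).

Lemma autD u : {morph u : y z / y + z}.
Proof. by move=> y z; have [uL _ _] := alg_autP u; rewrite -[y]scale1r uL !scale1r. Qed.

Lemma aut0 u : u 0 = 0.
Proof. by apply: (@addrI _ (u 0)); rewrite -autD !addr0. Qed.

Lemma autZ u c y : u (c *: y) = c *: u y.
Proof. by have [uL _ _] := alg_autP u; rewrite -[c *: y]addr0 uL aut0 addr0. Qed.

Lemma autB u : {morph u : y z / y - z}.
Proof. by move=> y z; rewrite autD -scaleN1r autZ scaleN1r. Qed.

Lemma autM u : {morph u : y z / y * z}.
Proof. by have [_ [_ uM] _] := alg_autP u. Qed.

Lemma aut1 u : u 1 = 1.
Proof. by have [_ [u1 _] _] := alg_autP u. Qed.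

Lemma aut_inj u : injective u.
Proof. by have [_ _ /bij_inj] := alg_autP u. Qed.

Lemma derD d : {morph d : y z / y + z}.
Proof. by move=> y z; have [dL _] := derivationP d; rewrite -[y]scale1r dL !scale1r. Qed.

Lemma der0 d : d 0 = 0.
Proof. by apply: (@addrI _ (d 0)); rewrite -derD !addr0. Qed.

Lemma derZ d c y : d (c *: y) = c *: d y.
Proof. by have [dL _] := derivationP d; rewrite -[c *: y]addr0 dL der0 addr0. Qed.

Lemma derM d y z : d (y * z) = d y * z + y * d z.
Proof. by have [_ dM] := derivationP d. Qed.

Lemma der1 d : d 1 = 0.
Proof. by apply: (@addrI _ (d 1)); rewrite addr0 -{3}[1]mulr1 derM mulr1 mul1r. Qed.

Fact inner_der_subproof (a : A) :
  (fun y => a * y - y * a) \in @derivation_pred K A.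
Proof.
apply/asboolP; split=> [c y z|y z].
  by rewrite mulrDr mulrDl -scalerAl -scalerAr opprD addrACA -scalerBr.
by rewrite mulrBl mulrBr !mulrA addrA subrK.
Qed.

Definition inner_der (a : A) : derivation A := Derivation (inner_der_subproof a).

Lemma der_act_inner u a : der_act u (inner_der a) = inner_der (u a).
Proof. by apply: derivation_eq => y /=; rewrite autB !autM aut_inv_funK. Qed.

Lemma inner_gsubmodule : @gsubmodule _ _ (Der A) (fun d => exists a, d = inner_der a).
Proof.
split=> [|c _ _ [a ->] [b ->]|u _ [a ->]].
- by exists 0; apply: derivation_eq => y /=; rewrite mul0r mulr0 subr0.
- exists (c *: a + b); apply: derivation_eq => y /=.
  by rewrite mulrDr mulrDl -scalerAl -scalerAr opprD addrACA -scalerBr.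
- by exists (u a); exact: der_act_inner.
Qed.

Lemma scale_gsubmodule (a : K) :
  @gsubmodule _ _ (Der A) (fun d => exists e : derivation A, d = a *: e).
Proof.
split=> [|c _ _ [d ->] [e ->]|u _ [d ->]].
- by exists 0; rewrite scaler0.
- by exists (c *: d + e); rewrite scalerDr !scalerA mulrC.
- by exists (der_act u d); apply: derivation_eq => y; exact: autZ.
Qed.

End AutomorphismsAndDerivations.

(** * The exterior algebra, handled through monomials and degree derivations *)

Section ExteriorAlgebra.
Variables (K : comNzRingType) (I : finType) (A : algType K).
Variables (mon : seq I -> A) (D : I -> derivation A).
Local Notation x i := (mon [:: i]).
Hypothesis monM : forall s t, mon s * mon t = mon (s ++ t).
Hypothesis mon_nil : mon [::] = 1.
Hypothesis mon_ind : forall P : A -> Prop,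
  P 0 -> (forall y z, P y -> P z -> P (y + z)) ->
  (forall c s, P (c *: mon s)) -> forall y, P y.
Hypothesis x_sqr : forall i, x i * x i = 0.
Hypothesis x_anticomm : forall i j, i != j -> x i * x j = - (x j * x i).
Hypothesis scale_x_inj : forall i c c', c *: x i = c' *: x i -> c = c'.
Hypothesis scale_xx_eq0 : forall i j c, i != j -> c *: (x i * x j) = 0 -> c = 0.
Hypothesis commutator_neq_x : forall i y z, y * z - z * y != x i.
Hypothesis D_mon : forall i s, D i (mon s) = (count_mem i s)%:R *: mon s.
Hypothesis half : exists h : K, h * 2%:R = 1.
Implicit Types (i j k : I) (s t r : seq I) (y z : A) (c : K).

Lemma mon_cons i s : mon (i :: s) = x i * mon s.
Proof. by rewrite monM. Qed.

Lemma D_x i j : D i (x j) = (i == j)%:R *: x j.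
Proof. by rewrite D_mon /= addn0 eq_sym. Qed.

Lemma double_eq0 c : c *+ 2 = 0 -> c = 0.
Proof.
by case: half => h h2 c2; rewrite -[c]mul1r -h2 -mulrA mulr_natl c2 mulr0.
Qed.

(** The left [x i] moves right through [s] up to sign until it meets another [x i]. *)
Lemma x_mon_x i s : x i * mon s * x i = 0.
Proof.
elim: s => [|k s IHs]; first by rewrite mon_nil mulr1 x_sqr.
rewrite (mon_cons k); have [<-|ik] := eqVneq i k.
  by rewrite !mulrA x_sqr !mul0r.
by rewrite mulrA x_anticomm // !mulNr -!mulrA [x i * _]mulrA IHs mulr0 oppr0.
Qed.

Lemma mon_dup s : ~~ uniq s -> mon s = 0.
Proof.
elim: s => //= i s IHs; rewrite negb_and negbK (mon_cons i) => /orP[|/IHs->].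
  by case/splitPr => s1 s2; rewrite -monM (mon_cons i s2) !mulrA x_mon_x mul0r.
by rewrite mulr0.
Qed.

(* On the monomials without repeated letters the D i are commuting            *)
(* projections, so D j composed with all 1 - D i, i != j, projects onto K x_j. *)
Lemma weight_x j y : (forall i, D i y = (i == j)%:R *: y) ->
  exists c, y = c *: x j.
Proof.
pose P r z := foldr (fun i v => v - D i v) z r => Dy.
have PD r z z' : P r (z + z') = P r z + P r z'.
  by elim: r => //= i r ->; rewrite derD opprD addrACA.
have P0 r : P r 0 = 0 by elim: r => //= i r ->; rewrite der0 subr0.
(* Each letter of [r] contributes a factor 1 minus its multiplicity in [s], which is 0 if it occurs
   exactly once. *)
have Pmon r c s : exists e, P r (c *: mon s) = e *: mon s /\
    (has (fun i => count_mem i s == 1%N) r -> e = 0).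
  elim: r => [|i r [e [rE e0]]]; first by exists c.
  exists (e * (1 - (count_mem i s)%:R)); split=> [/=|/=/orP[/eqP->|/e0->]].
  - by rewrite rE derZ D_mon scalerA mulrBr mulr1 scalerBl.
  - by rewrite subrr mulr0.
  - by rewrite mul0r.
pose r := [seq i <- enum I | i != j].
have P_x z : exists c, D j (P r z) = c *: x j.
  elim/mon_ind: z => [|z z' [c zE] [c' z'E]|c s].
  - by exists 0; rewrite P0 der0 scale0r.
  - by exists (c + c'); rewrite PD derD zE z'E scalerDl.
  have [e [-> e0]] := Pmon r c s.
  have [us|/mon_dup->] := boolP (uniq s); last first.
    by exists 0; rewrite scaler0 der0 scale0r.
  have [/e0->|] := boolP (has (fun i => count_mem i s == 1%N) r).
    by exists 0; rewrite scale0r der0 scale0r.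
  (* Only the letter [j] can now occur in [s], which has no repetition: [s] is empty, and then
     killed by [D j], or equal to [[:: j]]. *)
  move=> /hasPn s_j.
  have {}s_j i : i \in s -> i = j.
    move=> si; apply/eqP; apply: contraTT (si) => ij.
    have /s_j : i \in r by rewrite mem_filter ij mem_enum.
    by rewrite count_uniq_mem //; case: (i \in s).
  rewrite derZ D_mon; case: s us s_j {e0} => [|k [|l s]] us s_j.
  - by exists 0; rewrite scale0r scaler0 scale0r.
  - rewrite (s_j k) ?mem_head //; exists (e * (count_mem j [:: j])%:R).
    by rewrite scalerA.
  - move: us; rewrite (s_j k) ?mem_head // (s_j l) ?inE ?eqxx ?orbT //=.
    by rewrite inE eqxx.
(* For i != j the weight of [y] is 0, so each factor 1 - [D i] fixes [y]. *)
have Py : P r y = y.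
  rewrite /r; elim: (enum I) => //= i t IHt; case: eqVneq => //= ij.
  by rewrite IHt Dy (negPf ij) scale0r subr0.
have [c yE] := P_x y; exists c.
by rewrite -yE Py Dy eqxx scale1r.
Qed.

Lemma commute_der_id (u : alg_aut A) : (forall i, exists j, j != i) ->
  (forall (d : derivation A) y, u (d y) = d (u y)) -> u =1 id.
Proof.
move=> other ud.
have ux i : exists c, u (x i) = c *: x i.
  by apply: weight_x => j; rewrite -ud D_x autZ.
have comm_xx i j : i != j -> x i * x j - x j * x i = 2%:R *: (x i * x j).
  by move=> ij; rewrite [x j * _]x_anticomm 1?eq_sym // opprK scaler_nat mulr2n.
have u_x i : u (x i) = x i.
  have [j ji] := other i; have [c uxi] := ux i; have [c' uxj] := ux j.
  (* Both sides are multiples of [x i * x j], by 2 c c' on the left and 2 c' on the right. *)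
  have : u (inner_der (x i) (x j)) = inner_der (x i) (u (x j)) by exact: ud.
  rewrite /= comm_xx 1?eq_sym // autZ autM uxi uxj.
  rewrite -!scalerAl -!scalerAr -scalerBr comm_xx 1?eq_sym // !scalerA.
  move/eqP; rewrite -subr_eq0 -scalerBl => /eqP/scale_xx_eq0.
  rewrite eq_sym => /(_ ji) cc'.
  have {}cc' : c' * c = c'.
    apply/eqP; rewrite -subr_eq0; apply/eqP/double_eq0.
    by rewrite -mulr_natr mulrBl -[RHS]cc' mulrC (mulrC c') mulrA.
  (* As c' is not known to be cancellable, injectivity of [u] is used to get from c' c = c' to c =
     1. *)
  have /aut_inj : u (c *: x j) = u (x j) by rewrite autZ uxj scalerA mulrC cc'.
  by rewrite -[X in _ = X]scale1r => /scale_x_inj c1; rewrite c1 scale1r.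
have u_mon s : u (mon s) = mon s.
  elim: s => [|i s IHs]; first by rewrite mon_nil aut1.
  by rewrite (mon_cons i s) autM u_x IHs.
elim/mon_ind => [|y z yE zE|c s]; first exact: aut0.
- by rewrite autD yE zE.
- by rewrite autZ u_mon.
Qed.

(** If [s] and [t] act alike, then [t^-1 * s] fixes every derivation under conjugation, that is,
    commutes with it. *)
Lemma faithful_Der : (forall i, exists j, j != i) -> faithful_gmodule (Der A).
Proof.
move=> other s t st.
suff E : (t^-1 * s)%g = 1%g by rewrite -[s]mul1g -(mulgV t) -mulgA E mulg1.
apply: alg_aut_eq; apply: commute_der_id => // d y.
have : der_act (t^-1 * s)%g d = d.
  have -> : der_act (t^-1 * s)%g d = der_act (t^-1)%g (der_act s d).
    exact: der_actM.
  have -> : der_act s d = der_act t d by exact: (congr1 (@^~ d) st).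
  by rewrite -der_actM mulVg der_act1.
move: (t^-1 * s)%g => v /(congr1 (fun e : derivation A => e (v y))) /= <-.
by rewrite aut_funK.
Qed.

Lemma not_simple_Der_of_neq i j : i != j -> ~ simple_gmodule (Der A).
Proof.
move=> ij [_ /(_ _ (inner_gsubmodule A)) [U0|UT]].
  have /(congr1 (fun e : derivation A => e (x j))) /= : inner_der (x i) = 0.
    by apply: U0; exists (x i).
  rewrite [x j * _]x_anticomm 1?eq_sym // opprK -mulr2n -scaler_nat.
  move/(scale_xx_eq0 ij); case: half => h + two0.
  by rewrite two0 mulr0 => /esym/eqP; rewrite oner_eq0.
have [a /(congr1 (fun e : derivation A => e (x i)))] := UT (D i).
rewrite D_x eqxx scale1r /= => /esym/eqP.
by rewrite (negPf (commutator_neq_x _ _ _)).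
Qed.

(** * The case of one generator *)

Section OneVariable.
Variable i0 : I.
Hypothesis I_sub : forall i, i = i0.

Lemma one_var_decomp y : exists a b, y = a *: 1 + b *: x i0.
Proof.
elim/mon_ind: y => [|y z [a [b ->]] [a' [b' ->]]|c [|i [|j s]]].
- by exists 0, 0; rewrite !scale0r addr0.
- by exists (a + a'), (b + b'); rewrite !scalerDl addrACA.
- by exists c, 0; rewrite scale0r addr0 mon_nil.
- by exists 0, c; rewrite scale0r add0r (I_sub i).
- by exists 0, 0; rewrite mon_dup ?scaler0 ?scale0r ?addr0 // (I_sub i) (I_sub j)
    /= inE eqxx.
Qed.

(** Writing d x = a + b x, the relation x^2 = 0 gives 0 = d(x^2) = 2 a x, hence a = 0. *)
Lemma one_var_der (d : derivation A) : exists b, d (x i0) = b *: x i0.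
Proof.
have [a [b dx]] := one_var_decomp (d (x i0)).
suff a0 : a = 0 by exists b; rewrite dx a0 scale0r add0r.
have : d (x i0 * x i0) = 0 by rewrite x_sqr der0.
rewrite derM dx mulrDl mulrDr -!scalerAl -!scalerAr x_sqr mul1r mulr1.
rewrite !scaler0 !addr0 -scalerDl -(scale0r (x i0)) => /scale_x_inj.
exact: double_eq0.
Qed.

(** This is the automorphism x -> -x, expressed through the degree derivation so that linearity is
    immediate. *)
Let sgn y := y - 2%:R *: D i0 y.

Let sgnE a b : sgn (a *: 1 + b *: x i0) = a *: 1 - b *: x i0.
Proof.
rewrite /sgn derD !derZ der1 scaler0 add0r D_x eqxx scale1r -addrA; congr (_ + _).
by rewrite scalerA -scalerBl -scaleNr mulr_natl mulr2n opprD addNKr.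
Qed.

Fact sgn_is_alg_aut : `[< is_alg_aut sgn >].
Proof.
apply/asboolP; split.
- move=> c y z; rewrite /sgn derD derZ !scalerDr scalerN !scalerA opprD addrACA.
  by rewrite (mulrC c).
- split=> [|y z]; first by rewrite /sgn der1 scaler0 subr0.
  have [a [b ->]] := one_var_decomp y; have [a' [b' ->]] := one_var_decomp z.
  have E p q p' q' : (p *: 1 + q *: x i0) * (p' *: 1 + q' *: x i0) =
      (p * p') *: 1 + (p * q' + q * p') *: x i0.
    rewrite mulrDl !mulrDr -!scalerAl -!scalerAr x_sqr !mul1r mulr1 !scaler0 addr0.
    by rewrite !scalerA scalerDl addrA.
  by rewrite E !sgnE -!scaleNr E mulrN mulNr opprD.
- exists sgn => y; have [a [b ->]] := one_var_decomp y;
    by rewrite sgnE -scaleNr sgnE scaleNr opprK.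
Qed.

(** Every derivation kills 1 and scales x, so it commutes with [sgn]; yet [sgn] is not the identity,
    since -1 = 1 would give 2 = 0. *)
Lemma not_faithful_Der : ~ faithful_gmodule (Der A).
Proof.
pose u := AlgAut sgn_is_alg_aut.
have u1 : @gact _ _ (Der A) u = @gact _ _ (Der A) 1%g.
  apply/funext => d; rewrite [RHS]der_act1.
  apply: derivation_eq => y.
  (* Evaluating at a point of the form [u z] cancels the inverse in the action. *)
  have -> : y = u (aut_inv_fun u y) by rewrite aut_inv_funK.
  rewrite [LHS]/= aut_funK; move: (aut_inv_fun u y) => z.
  have [b dx] := one_var_der d; have [a [c ->]] := one_var_decomp z.
  rewrite [u (_ + _)]sgnE derD !derZ der1 dx -scaleNr derD !derZ der1 dx.
  rewrite !scaler0 !add0r !scalerA mulNr scaleNr.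
  by rewrite -[_ *: x i0 in LHS]add0r -[0](scale0r 1) [LHS]sgnE scale0r add0r.
move=> /(_ _ _ u1) /(congr1 (fun v : alg_aut A => v (x i0))).
have <- : 0 *: 1 + 1 *: x i0 = x i0 by rewrite scale0r add0r scale1r.
rewrite [LHS]sgnE scale0r sub0r add0r -scaleNr => /scale_x_inj /eqP.
rewrite eq_sym -addr_eq0 => /eqP/(double_eq0)/eqP.
by rewrite oner_eq0.
Qed.

(** The submodule a Der contains the nonzero [a *: D i0]; if it contained [D i0] = a d with d x = b
    x, then a b = 1. *)
Lemma not_simple_Der_of_nonunit (a : K) : a != 0 -> (forall b, a * b <> 1) ->
  ~ simple_gmodule (Der A).
Proof.
move=> a0 aU [_ /(_ _ (scale_gsubmodule A a)) [U0|UT]].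
  have /(congr1 (fun e : derivation A => e (x i0))) /= : a *: D i0 = 0.
    by apply: U0; exists (D i0).
  rewrite [LHS](_ : _ = a *: D i0 (x i0)) // D_x eqxx scale1r.
  rewrite [RHS](_ : _ = 0 *: x i0); last by rewrite scale0r.
  by move/scale_x_inj/eqP; rewrite (negPf a0).
have [d /(congr1 (fun e : derivation A => e (x i0)))] := UT (D i0).
rewrite [RHS](_ : _ = a *: d (x i0)) // D_x eqxx.
by have [b ->] := one_var_der d; rewrite scalerA => /scale_x_inj /esym /aU.
Qed.

End OneVariable.
End ExteriorAlgebra.

(* The case excluded in the second part is the one in which the assertion     *)
(* fails: for n = 1, Der_K(K[x]/(x^2)) = K x d/dx is free of rank one over K, *)
(* which is a simple module when K is a field.                                *)
Theorem theorem2p10 (K : comNzRingType) (Kred : reduced K)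
    (half : exists h : K, h * 2%:R = 1) (n : nat) (n_ge1 : (1 <= n)%N) :
  (faithful_gmodule (Der (grassmann K n)) <-> (2 <= n)%N) /\
  (~ (n = 1%N /\ is_field K) -> ~ simple_gmodule (Der (grassmann K n))).
Proof.
have [n_gt1|n_le1] := ltnP 1 n.
  pose o0 := Ordinal n_ge1; pose o1 := Ordinal n_gt1.
  have o01 : o0 != o1 by [].
  split=> [|_]; last exact: (not_simple_Der_of_neq (@mon_anticomm K n)
    (@scale_mon2_eq0 K n) (@commutator_neq_mon1 K n) (@gr_der_mon K n) half o01).
  split=> // _; apply: (faithful_Der (@monM K n) (@mon_nil K n) (@mon_ind K n)
    (@mon_sqr K n) (@mon_anticomm K n) (@scale_mon1_inj K n)
    (@scale_mon2_eq0 K n) (@gr_der_mon K n) half) => i.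
  by have [->|i0] := eqVneq i o0; [exists o1|exists o0; rewrite eq_sym].
have n1 : n = 1%N by apply/eqP; rewrite eqn_leq n_le1.
have I_sub (i : 'I_n) : i = Ordinal n_ge1.
  by apply/val_inj/eqP; rewrite /= -leqn0 -ltnS (leq_trans (ltn_ord i) n_le1).
split=> [|not_field].
  by split=> // /(not_faithful_Der (@monM K n) (@mon_nil K n) (@mon_ind K n)
    (@mon_sqr K n) (@mon_anticomm K n) (@scale_mon1_inj K n)
    (@gr_der_mon K n) half I_sub).
(* With n = 1, [K] is not a field, so classical logic provides a nonzero nonunit. *)
have [a a0 aU] : exists2 a : K, a != 0 & forall b, a * b <> 1.
  apply: contrapT => no_a; apply: not_field; split=> // a a0.
  apply: contrapT => a_nonunit; apply: no_a; exists a => // b ab.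
  by apply: a_nonunit; exists b.
exact: (not_simple_Der_of_nonunit (@monM K n) (@mon_nil K n) (@mon_ind K n)
  (@mon_sqr K n) (@mon_anticomm K n) (@scale_mon1_inj K n) (@gr_der_mon K n)
  half I_sub a0 aU).
Qed.
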